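(* Let $(A,C)$ be an observable system with $A\in\mathbb{R}^{n\times n}$, $C\in\mathbb{R}^{r\times n}$, every row of $C$ nonzero, such that the geometric multiplicities of all eigenvalues of $A$ are bounded by $\bar k$. Then Algorithm 1 (described in the context) determines an optimal solution to the problem $$\min_{S\subseteq V}|S|\quad\text{s.t. } (A,C_{V\setminus S})\ \text{is unobservable},\qquad V=\{1,\dots,r\},$$ in time complexity at most $O(\bar k^{2}r^{\bar k+1}n+rn^{3})$.
   Context: The pair $(A,C)$ describes the system $\dot x=Ax$, $y=Cx$; $M_J$ denotes the submatrix of $M$ consisting of the rows indexed by $J$ (the empty matrix has rank $0$). Observability is the usual notion: no $\lambda\in\mathbb{C}$ and nonzero $x\in\mathbb{C}^n$ satisfy $Ax=\lambda x$, $Cx=0$. Let $\lambda_1,\dots,\lambda_p$ be the distinct eigenvalues of $A$, $k_i$ the geometric multiplicity of $\lambda_i$ (so $k_i\le\bar k$), $X_i$ an $n\times k_i$ matrix whose columns form a basis of the null space of $\lambda_iI-A$, and $Y^{(i)}=CX_i$. It is assumed that a collection of eigenbases $X_1,\dots,X_p$ is computationally available. Time is counted in arithmetic operations, where the rank of an $s\times k$ matrix is computed in $O(sk^2)$ operations. Algorithm 1. For each $\kappa=1,\dots,p$ do the following. Build a tree of subsets of $V$, layer by layer, for $\tau=0,1,\dots,k_\kappa-1$. Layer $0$ starts from the single set $T^{0}_1=\emptyset$. In layer $\tau$, given the sets $T^\tau_1,\dots,T^\tau_{L_{\tau-1}}$ (with $L_{-1}=1$), for each $i$ set $$\bar T^\tau_i=T^\tau_i\cup\{j\in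 V\setminus T^\tau_i:\ \mathrm{rank}\,Y^{(\kappa)}_{T^\tau_i\cup\{j\}}=\mathrm{rank}\,Y^{(\kappa)}_{T^\tau_i}\},\qquad \Omega^\tau_i=V\setminus\bar T^\tau_i,$$ and let the children of node $i$ be the $|\Omega^\tau_i|$ sets $\bar T^\tau_i\cup\{j\}$, $j\in\Omega^\tau_i$. The sets $T^{\tau+1}_1,\dots,T^{\tau+1}_{L_\tau}$ are all children of all nodes $i=1,\dots,L_{\tau-1}$, listed in order, with $L_\tau=\sum_{i=1}^{L_{\tau-1}}|\Omega^\tau_i|$. Let $T^{[\kappa]}_{\max}$ be a set of maximum cardinality among $\bar T^{k_\kappa-1}_1,\dots,\bar T^{k_\kappa-1}_{L_{k_\kappa-2}}$, and $F_\kappa=V\setminus T^{[\kappa]}_{\max}$. Finally, return $F_{\min}$, a set of minimum cardinality among $F_1,\dots,F_p$. *)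

(* Defs.v *)
From mathcomp Require Import all_boot all_order all_algebra.
From mathcomp Require Import complex reals.

Set Implicit Arguments.
Unset Strict Implicit.
Unset Printing Implicit Defensive.

Import GRing.Theory.
Local Open Scope ring_scope.

(** ** Systems *)

Definition toC (R : realType) (m n : nat) (M : 'M[R]_(m, n)) : 'M[R[i]]_(m, n) :=
  map_mx (real_complex R) M.

(* Rows are taken in increasing order of index; for J = set0 this is the
   0 x n matrix, of rank 0. *)
Definition rows_in (T : Type) (r n : nat) (M : 'M[T]_(r, n)) (J : {set 'I_r}) :
    'M[T]_(#|J|, n) :=
  rowsub (fun i : 'I_#|J| => enum_val i) M.

Definition unobservable (R : realType) (n m : nat)
    (A : 'M[R]_n) (C : 'M[R]_(m, n)) : Prop :=
  exists (z : R[i]) (x : 'cV[R[i]]_n),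
    [/\ x != 0, toC A *m x = z *: x & toC C *m x = 0].

Definition observable (R : realType) (n m : nat)
    (A : 'M[R]_n) (C : 'M[R]_(m, n)) : Prop :=
  ~ unobservable A C.

Definition optimal_solution (R : realType) (n r : nat)
    (A : 'M[R]_n) (C : 'M[R]_(r, n)) (S : {set 'I_r}) : Prop :=
  unobservable A (rows_in C (~: S)) /\
  forall S' : {set 'I_r},
    unobservable A (rows_in C (~: S')) -> (#|S| <= #|S'|)%N.

(* The columns of [cokermx M] span the null space {x | M *m x = 0}. *)
Definition geo_mult (R : realType) (n : nat) (A : 'M[R]_n) (z : R[i]) : nat :=
  \rank (cokermx (z%:M - toC A)).

Definition null_basis (F : fieldType) (n k : nat)
    (M : 'M[F]_n) (X : 'M[F]_(n, k)) : Prop :=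
  (forall x : 'cV[F]_n, M *m x = 0 <-> exists c : 'cV[F]_k, x = X *m c) /\
  (forall c : 'cV[F]_k, X *m c = 0 -> c = 0).

Definition enumerates_eigenvalues (R : realType) (n p : nat)
    (A : 'M[R]_n) (lam : 'I_p -> R[i]) : Prop :=
  injective lam /\
  forall z : R[i], eigenvalue (toC A) z <-> exists i : 'I_p, lam i = z.

(** ** Computations with operation counts

    [m v t] means that the computation [m] may return the value [v] after
    exactly [t] operations.  The relation is nondeterministic because ties in
    the choice of a set of extremal cardinality are broken arbitrarily, and
    because only an upper bound on the cost of a rank computation is known. *)

Definition comp (T : Type) : Type := T -> nat -> Prop.

Definition ret (T : Type) (x : T) : comp T :=
  fun v t => v = x /\ t = 0%N.

Definition bind (T U : Type) (m : comp T) (f : T -> comp U) : comp U :=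
  fun v t => exists (x : T) (t1 t2 : nat),
    [/\ m x t1, f x v t2 & t = (t1 + t2)%N].

Notation "'let!' x ':=' m 'in' f" := (bind m (fun x => f))
  (at level 200, x name, m at level 100, f at level 200,
   format "'[v' 'let!'  x  ':='  m  'in' '/' f ']'").

Fixpoint mapM (T U : Type) (f : T -> comp U) (s : seq T) : comp (seq U) :=
  if s is x :: s' then
    let! y := f x in
    let! ys := mapM f s' in
    ret (y :: ys)
  else ret [::].

Fixpoint filterM (T : Type) (f : T -> comp bool) (s : seq T) : comp (seq T) :=
  if s is x :: s' then
    let! b := f x in
    let! ys := filterM f s' in
    ret (if b then x :: ys else ys)
  else ret [::].

(** Primitive operations.  Each field operation, each addition or comparison of
    integers counts as one operation; bookkeeping on sets is not counted. *)

(* Schoolbook product: n multiplications and n - 1 additions per entry. *)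
Definition mul_op (F : fieldType) (m n k : nat)
    (M : 'M[F]_(m, n)) (N : 'M[F]_(n, k)) : comp 'M[F]_(m, k) :=
  fun P t => P = M *m N /\ t = (m * k * (n + n.-1))%N.

(* [c] is the constant hidden in the O(s k^2) cost of a rank computation. *)
Definition rank_op (c : nat) (F : fieldType) (s k : nat)
    (M : 'M[F]_(s, k)) : comp nat :=
  fun v t => v = \rank M /\ (t <= c * (s * k ^ 2))%N.

Definition eq_op_nat (a b : nat) : comp bool :=
  fun v t => v = (a == b) /\ t = 1%N.

(* Computing each cardinality takes r additions, and finding an extremal one
   size s - 1 comparisons.  There is no possible outcome when s is empty. *)
Definition max_card_op (r : nat) (s : seq {set 'I_r}) : comp {set 'I_r} :=
  fun T t => [/\ T \in s, forall U, U \in s -> (#|U| <= #|T|)%N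
               & t = (size s * r + (size s).-1)%N].

Definition min_card_op (r : nat) (s : seq {set 'I_r}) : comp {set 'I_r} :=
  fun T t => [/\ T \in s, forall U, U \in s -> (#|T| <= #|U|)%N
               & t = (size s * r + (size s).-1)%N].

(** ** The algorithm *)

Section Algorithm.

Variables (c : nat) (F : fieldType) (r : nat).

Section Tree.

Variables (k : nat) (Y : 'M[F]_(r, k)).

Definition closure_op (T : {set 'I_r}) : comp {set 'I_r} :=
  let! rT := rank_op c (rows_in Y T) in
  let! js := filterM (fun j =>
               let! rj := rank_op c (rows_in Y (j |: T)) in
               eq_op_nat rj rT) (enum (~: T)) in
  ret (T :|: [set j in js]).

Definition children (Tbar : {set 'I_r}) : seq {set 'I_r} :=
  [seq j |: Tbar | j <- enum (~: Tbar)].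

(* Processes a layer consisting of the sets [Ts] and then [m] further layers;
   returns the closed sets of the last one, whose children are never used. *)
Fixpoint layers (m : nat) (Ts : seq {set 'I_r}) : comp (seq {set 'I_r}) :=
  let! Tbars := mapM closure_op Ts in
  if m is m'.+1 then layers m' (flatten [seq children Tbar | Tbar <- Tbars])
  else ret Tbars.

End Tree.

Definition algorithm1 (n p : nat) (C : 'M[F]_(r, n)) (k : 'I_p -> nat)
    (X : forall i : 'I_p, 'M[F]_(n, k i)) : comp {set 'I_r} :=
  let! Fs := mapM (fun i : 'I_p =>
               let! Y := mul_op C (X i) in
               let! Tbars := layers Y (k i).-1 [:: set0] in
               let! Tmax := max_card_op Tbars in
               ret (~: Tmax)) (enum 'I_p) in
  min_card_op Fs.

End Algorithm.

(* Main.v *)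
(** Let [Y_i = C X_i].  A coordinate vector [u] with [Y_i u = 0] on the rows in
    [T] is the same as an eigenvector [X_i u] for [lam i] annihilated by the
    rows of [C] in [T], so [(A, C_T)] is unobservable iff
    [\rank (Y_i)_T < k_i] for some [i].  Hence an optimal [S] is the complement
    of a largest set [T] with [\rank (Y_i)_T < k_i], over all [i].  Such a [T] is
    a flat of rank [k_i - 1] of the matroid of the rows of [Y_i], and the last
    layer of the tree consists of these flats: a set that is to be covered
    dictates which child to follow, and any child will do once the current flat
    contains it.  A layer has at most [r] times as many nodes as the preceding
    one, so the last layer dominates the cost, and it costs
    [O(r ^ (k_i - 1) * k_i ^ 2 * r ^ 2)]. *)

Require Import Defs.
From mathcomp Require Import all_boot all_order all_algebra.
From mathcomp Require Import complex reals.
From mathcomp Require Import zify ring.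

Set Implicit Arguments.
Unset Strict Implicit.
Unset Printing Implicit Defensive.

Import GRing.Theory.
Local Open Scope ring_scope.

(** * Rules for reasoning about costed computations *)

(* Total correctness: besides bounding every run, [spec] asserts that a run
   exists, which is not automatic since [max_card_op] and [min_card_op] are
   stuck on the empty sequence. *)
Definition spec (T : Type) (m : Defs.comp T) (P : T -> Prop) (B : nat) : Prop :=
  (exists v t, m v t) /\ forall v t, m v t -> P v /\ (t <= B)%N.

Lemma spec_ret (T : Type) (x : T) (P : T -> Prop) : P x -> spec (ret x) P 0.
Proof. by move=> Px; split=> [|v t [-> ->]]; first by exists x, 0%N. Qed.

Lemma spec_bind (T U : Type) (m : Defs.comp T) (f : T -> Defs.comp U) P Q B1 B2 :
  spec m P B1 -> (forall x, P x -> spec (f x) Q B2) ->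
  spec (bind m f) Q (B1 + B2).
Proof.
move=> [[x [t1 mx]] m_ok] f_ok; split.
  have [Px _] := m_ok _ _ mx; have [[y [t2 fy]] _] := f_ok x Px.
  by exists y, (t1 + t2)%N, x, t1, t2.
move=> v _ [z [u1 [u2 [mz fz ->]]]].
have [Pz le_u1] := m_ok _ _ mz; have [_ /(_ _ _ fz) [Qv le_u2]] := f_ok z Pz.
by split=> //; apply: leq_add.
Qed.

Lemma spec_weaken (T : Type) (m : Defs.comp T) (P Q : T -> Prop) B1 B2 :
  spec m P B1 -> (forall v, P v -> Q v) -> (B1 <= B2)%N -> spec m Q B2.
Proof.
move=> [m_ex m_ok] PQ leB; split=> // v t /m_ok [/PQ Qv le_t].
by split=> //; apply: leq_trans leB.
Qed.

Lemma spec_leq (T : Type) (m : Defs.comp T) (P : T -> Prop) B1 B2 :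
  spec m P B1 -> (B1 <= B2)%N -> spec m P B2.
Proof. by move=> m_ok; apply: spec_weaken m_ok _. Qed.

(** Both directions are kept: optimality needs an output for every input, feasibility an input
    behind every output. *)
Lemma spec_mapM (T U : eqType) (f : T -> Defs.comp U) (s : seq T) P B :
  (forall x, x \in s -> spec (f x) (P x) B) ->
  spec (mapM f s)
    (fun ys => [/\ size ys = size s,
                  forall x, x \in s -> exists2 y, y \in ys & P x y
                & forall y, y \in ys -> exists2 x, x \in s & P x y])
    (size s * B).
Proof.
elim: s => [|x s IHs] f_ok /=; first exact: spec_ret.
rewrite mulSn; apply: (spec_bind (f_ok x (mem_head _ _))) => y Pxy.
have f_ok' z : z \in s -> spec (f z) (P z) B.
  by move=> zs; apply: f_ok; rewrite in_cons zs orbT.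
rewrite -[(size s * B)%N]addn0.
apply: (spec_bind (IHs f_ok')) => ys [sz_ys s_ys ys_s].
apply: spec_ret; split=> [|z|z]; first by rewrite /= sz_ys.
  rewrite in_cons => /predU1P[->|/s_ys[w w_ys Pzw]].
    by exists y; rewrite ?mem_head.
  by exists w; rewrite // in_cons w_ys orbT.
rewrite in_cons => /predU1P[->|/ys_s[w w_s Pzw]].
  by exists x; rewrite ?mem_head.
by exists w; rewrite // in_cons w_s orbT.
Qed.

Lemma spec_filterM (T : eqType) (f : T -> Defs.comp bool) (a : pred T) s B :
  (forall x, x \in s -> spec (f x) (eq^~ (a x)) B) ->
  spec (filterM f s) (eq^~ (filter a s)) (size s * B).
Proof.
elim: s => [|x s IHs] f_ok /=; first exact: spec_ret.
rewrite mulSn; apply: (spec_bind (f_ok x (mem_head _ _))) => b ->.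
rewrite -[(size s * B)%N]addn0.
have f_ok' z : z \in s -> spec (f z) (eq^~ (a z)) B.
  by move=> zs; apply: f_ok; rewrite in_cons zs orbT.
by apply: (spec_bind (IHs f_ok')) => ys ->; apply: spec_ret.
Qed.

(** * Primitive operations *)

Lemma spec_rank_op (c : nat) (F : fieldType) (s k : nat) (M : 'M[F]_(s, k)) :
  spec (rank_op c M) (eq^~ (\rank M)) (c * (s * k ^ 2)).
(* Only an upper bound on the cost is prescribed, so a run of cost 0 witnesses existence. *)
Proof. by split=> //; exists (\rank M), 0%N. Qed.

Lemma spec_eq_op_nat (a b : nat) : spec (eq_op_nat a b) (eq^~ (a == b)) 1.
Proof. by split=> [|v t [-> ->]]; first by exists (a == b), 1%N. Qed.

Lemma spec_mul_op (F : fieldType) (m n k : nat)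
    (M : 'M[F]_(m, n)) (N : 'M[F]_(n, k)) :
  spec (mul_op M N) (eq^~ (M *m N)) (m * k * (n + n.-1)).
Proof.
by split=> [|v t [-> ->]]; first by exists (M *m N), (m * k * (n + n.-1))%N.
Qed.

Lemma seq_argmax (T : eqType) (f : T -> nat) (s : seq T) :
  (0 < size s)%N -> exists2 x, x \in s & forall y, y \in s -> (f y <= f x)%N.
Proof.
elim: s => // x [_ _|y s /(_ isT) [z z_s max_z] _].
  by exists x; rewrite ?mem_head // => y; rewrite inE => /eqP->.
have [le_xz|lt_zx] := leqP (f x) (f z).
  exists z; first by rewrite in_cons z_s orbT.
  by move=> w; rewrite in_cons => /predU1P[->|/max_z].
exists x; first exact: mem_head.
move=> w; rewrite in_cons => /predU1P[->//|/max_z le_wz].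
exact: leq_trans le_wz (ltnW lt_zx).
Qed.

Lemma seq_argmin (T : eqType) (f : T -> nat) (s : seq T) :
  (0 < size s)%N -> exists2 x, x \in s & forall y, y \in s -> (f x <= f y)%N.
Proof.
elim: s => // x [_ _|y s /(_ isT) [z z_s min_z] _].
  by exists x; rewrite ?mem_head // => y; rewrite inE => /eqP->.
have [le_zx|lt_xz] := leqP (f z) (f x).
  exists z; first by rewrite in_cons z_s orbT.
  by move=> w; rewrite in_cons => /predU1P[->|/min_z].
exists x; first exact: mem_head.
move=> w; rewrite in_cons => /predU1P[->//|/min_z].
exact: leq_trans (ltnW lt_xz).
Qed.

Lemma spec_max_card_op (r : nat) (s : seq {set 'I_r}) :
  (0 < size s)%N ->
  spec (max_card_op s)
    (fun T => T \in s /\ forall U, U \in s -> (#|U| <= #|T|)%N)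
    (size s * r + size s).
Proof.
move=> /(seq_argmax (fun U : {set 'I_r} => #|U|))[T T_s max_T].
split=> [|v t [v_s max_v ->]]; first by exists T; eexists; split.
by split=> //; rewrite leq_add2l leq_pred.
Qed.

Lemma spec_min_card_op (r : nat) (s : seq {set 'I_r}) :
  (0 < size s)%N ->
  spec (min_card_op s)
    (fun T => T \in s /\ forall U, U \in s -> (#|T| <= #|U|)%N)
    (size s * r + size s).
Proof.
move=> /(seq_argmin (fun U : {set 'I_r} => #|U|))[T T_s min_T].
split=> [|v t [v_s min_v ->]]; first by exists T; eexists; split.
by split=> //; rewrite leq_add2l leq_pred.
Qed.

(** * Flats of the row matroid of a matrix *)

Section RowMatroid.

Variables (F : fieldType) (r k : nat) (Y : 'M[F]_(r, k)).
Implicit Types T U : {set 'I_r}.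

(** The flat spanned by [T], given by row spaces; [rank_rows_inU1_eq] matches it with the rank test
    of the algorithm. *)
Definition closure_rows T : {set 'I_r} :=
  [set j | (row j Y <= rows_in Y T)%MS].

Lemma row_rows_in T j : j \in T -> (row j Y <= rows_in Y T)%MS.
Proof.
move=> jT; rewrite -(enum_rankK_in jT jT) -[X in row X _]/((fun i => enum_val i) _).
by rewrite -row_rowsub row_sub.
Qed.

Lemma rows_in_subP T (m : nat) (M : 'M[F]_(m, k)) :
  (forall j, j \in T -> (row j Y <= M)%MS) <-> (rows_in Y T <= M)%MS.
Proof.
split=> [TM|TM j /row_rows_in jT]; last exact: submx_trans TM.
by apply/row_subP=> i; rewrite row_rowsub; apply/TM/enum_valP.
Qed.

Lemma rows_inS T U : T \subset U -> (rows_in Y T <= rows_in Y U)%MS.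
Proof. by move=> /subsetP TU; apply/rows_in_subP => j /TU/row_rows_in. Qed.

Lemma rank_rows_inS T U :
  T \subset U -> (\rank (rows_in Y T) <= \rank (rows_in Y U))%N.
Proof. by move=> /rows_inS/mxrankS. Qed.

Lemma sub_closure_rows T : T \subset closure_rows T.
Proof. by apply/subsetP=> j jT; rewrite inE row_rows_in. Qed.

Lemma rows_in_closure T : (rows_in Y (closure_rows T) <= rows_in Y T)%MS.
Proof. by apply/rows_in_subP => j; rewrite inE. Qed.

Lemma rows_inU1 j T : (rows_in Y (j |: T) <= row j Y + rows_in Y T)%MS.
Proof.
apply/rows_in_subP=> i; rewrite !inE => /predU1P[->|iT].
  exact: addsmxSl.
exact: submx_trans (row_rows_in iT) (addsmxSr _ _).
Qed.

Lemma rank_rows_inU1_le j T :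
  (\rank (rows_in Y (j |: T)) <= (\rank (rows_in Y T)).+1)%N.
Proof.
apply: leq_trans (mxrankS (rows_inU1 j T)) _.
apply: leq_trans (mxrank_adds_leqif _ _) _.
by rewrite -[leqRHS]add1n leq_add2r rank_leq_row.
Qed.

Lemma rank_rows_inU1_eq j T :
  (\rank (rows_in Y (j |: T)) == \rank (rows_in Y T)) = (j \in closure_rows T).
Proof.
have sTjT : (rows_in Y T <= rows_in Y (j |: T))%MS by rewrite rows_inS ?subsetUr.
rewrite inE eq_sym (mxrank_leqif_sup sTjT).2.
apply/idP/idP=> [|jT]; first by move/rows_in_subP; apply; rewrite setU11.
by apply/rows_in_subP=> i /setU1P[->//|]; apply: row_rows_in.
Qed.

Lemma rank_closure T :
  \rank (rows_in Y (closure_rows T)) = \rank (rows_in Y T).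
Proof.
apply/eqP; rewrite eqn_leq mxrankS ?rows_in_closure //=.
by rewrite rank_rows_inS ?sub_closure_rows.
Qed.

(** One row raises the rank by at most one, and [j |: T] already has larger rank than [T]. *)
Lemma rank_rows_in_child j T : j \notin closure_rows T ->
  \rank (rows_in Y (j |: closure_rows T)) = (\rank (rows_in Y T)).+1.
Proof.
move=> jT; apply/eqP; rewrite eqn_leq -{1}(rank_closure T) rank_rows_inU1_le /=.
have le_jT : j |: T \subset j |: closure_rows T by rewrite setUS ?sub_closure_rows.
apply: leq_trans (rank_rows_inS le_jT).
by rewrite ltn_neqAle eq_sym rank_rows_inU1_eq jT rank_rows_inS ?subsetUr.
Qed.

(** The closure adds only rows in the row space of [T], hence of [U]. So a set to be covered may
    absorb the current flat. *)
Lemma rank_rows_inU_closure T U : T \subset U ->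
  \rank (rows_in Y (closure_rows T :|: U)) = \rank (rows_in Y U).
Proof.
move=> sTU; apply/eqP; rewrite eqn_leq [X in _ && X]rank_rows_inS ?subsetUr // andbT.
apply/mxrankS/rows_in_subP=> j /setUP[|/row_rows_in//].
by rewrite inE => jT; apply: submx_trans jT (rows_inS sTU).
Qed.

Lemma rank_rows_in0 : \rank (rows_in Y set0) = 0%N.
Proof. by apply/eqP; rewrite -leqn0 -(cards0 'I_r) rank_leq_row. Qed.

Lemma exists_notin_closure T :
  (\rank (rows_in Y T) < \rank Y)%N -> exists j, j \notin closure_rows T.
Proof.
move=> ltTY; apply/existsP; rewrite -negb_forall; apply: contraL ltTY => /forallP clT.
by rewrite -leqNgt; apply/mxrankS/row_subP=> j; have := clT j; rewrite inE.
Qed.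

(** * Cost and correctness of the tree of flats *)

Variable c : nat.
Hypotheses (k_gt0 : (0 < k)%N) (r_gt0 : (0 < r)%N).

(** In [c.*2.+1], one [c] pays for the rank of [T], the other for the ranks in the tests, and the 1
    for the comparisons. *)
Lemma spec_closure_op T :
  spec (closure_op c Y T) (eq^~ (closure_rows T)) (c.*2.+1 * (k ^ 2 * r ^ 2)).
Proof.
have le_Tr : (#|T| <= r)%N by rewrite -[leqRHS](card_ord r) max_card.
have sz : size (enum (~: T)) = (r - #|T|)%N by rewrite -cardE cardsCs setCK card_ord.
pose B := (c * (#|T|.+1 * k ^ 2) + 1)%N.
apply: (@spec_leq _ _ _
  (c * (#|T| * k ^ 2) + (size (enum (~: T)) * B + 0))).
  apply: (spec_bind (spec_rank_op _ _)) => _ ->.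
  have: forall j, j \in enum (~: T) -> spec
      (let! rj := rank_op c (rows_in Y (j |: T)) in
       eq_op_nat rj (\rank (rows_in Y T)))
      (eq^~ (j \in closure_rows T)) B.
    move=> j; rewrite mem_enum inE => jT.
    have cardU1 : #|j |: T| = #|T|.+1 by rewrite cardsU1 jT.
    rewrite -rank_rows_inU1_eq /B -cardU1.
    apply: (spec_bind (spec_rank_op _ _)) => _ ->; exact: spec_eq_op_nat.
  move/spec_filterM/spec_bind; apply=> _ ->; apply: spec_ret.
  apply/setP=> j; rewrite !inE mem_filter mem_enum !inE.
  by case: (boolP (j \in T)) => //= [/row_rows_in->|]; rewrite ?andbT.
rewrite sz addn0 /B.
have le_rank : (#|T| * k ^ 2 <= k ^ 2 * r ^ 2)%N.
  by rewrite mulnC leq_mul2l (leq_trans le_Tr) ?orbT // leq_pmulr.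
have le_ranks : ((r - #|T|) * (#|T|.+1 * k ^ 2) <= k ^ 2 * r ^ 2)%N.
  rewrite mulnA [leqRHS]mulnC leq_mul2r -[(r ^ 2)%N]mulnn; apply/orP; right.
  (* For [#|T| = r] the factor [#|T|.+1] exceeds [r], but no row is left to test. *)
  have [->|lt_Tr] : #|T| = r \/ (#|T| < r)%N by lia.
    by rewrite subnn.
  by apply: leq_mul; rewrite ?leq_subr.
have le_eqs : (r - #|T| <= k ^ 2 * r ^ 2)%N.
  apply: leq_trans (leq_subr _ _) _.
  by rewrite -[(r ^ 2)%N]mulnn mulnA leq_pmull // muln_gt0 expn_gt0 k_gt0.
rewrite mulnDr muln1 (mulnCA (r - #|T|)%N) [leqRHS]mulSn -addnn mulnDl.
rewrite [leqRHS]addnC -addnA.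
by rewrite !leq_add ?leq_mul2l ?le_rank ?le_ranks ?orbT.
Qed.

(* For [2 <= r] or [m = 0], [2 * r ^ m - 1] bounds [1 + r + ... + r ^ m], and
   [m < r] guarantees that one of them holds. *)
Lemma spec_layers m (Ts : seq {set 'I_r}) :
  (m < r)%N ->
  spec (layers c Y m Ts)
    (fun Vs => [/\ (size Vs <= size Ts * r ^ m)%N,
       forall V, V \in Vs -> exists2 T, T \in Ts &
         (\rank (rows_in Y V) <= \rank (rows_in Y T) + m)%N
     & forall T U, T \in Ts -> T \subset U ->
         (\rank (rows_in Y U) <= \rank (rows_in Y T) + m < \rank Y)%N ->
         exists2 V, V \in Vs & U \subset V])
    ((2 * r ^ m - 1) * size Ts * (c.*2.+1 * (k ^ 2 * r ^ 2))).
Proof.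
pose B := (c.*2.+1 * (k ^ 2 * r ^ 2))%N; rewrite -/B.
elim: m Ts => [|m IHm] Ts lt_mr.
  apply: (@spec_weaken _ _ _ _ (size Ts * B + 0)).
    apply: (spec_bind (spec_mapM (fun T _ => spec_closure_op T))).
    move=> Vs [sz TsVs VsTs]; apply: spec_ret.
    (* This term also fixes the intermediate postcondition left open above. *)
    exact: (conj sz (conj TsVs VsTs)).
  - move=> Vs [sz [TsVs VsTs]]; split; first by rewrite sz muln1.
      move=> V /VsTs[T TTs ->]; exists T => //.
      by rewrite addn0 rank_closure.
    move=> T U TTs sTU /andP[]; rewrite addn0 => leUT _.
    have [V VVs defV] := TsVs T TTs; exists V => //; rewrite defV.
    (* As [U] contains [T] without exceeding its rank, adding a row of [U] to [T] cannot raise the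
       rank. *)
    apply/subsetP=> j jU; rewrite -rank_rows_inU1_eq eqn_leq.
    rewrite [X in _ && X]rank_rows_inS ?subsetUr // andbT.
    by apply: leq_trans leUT; rewrite rank_rows_inS // subUset sub1set jU.
  - by rewrite expn0 muln1 mul1n addn0.
apply: (@spec_leq _ _ _
  (size Ts * B + (2 * r ^ m - 1) * (size Ts * r) * B)); last first.
  rewrite -mulnDl leq_mul2r; apply/orP; right.
  have rm_gt0 : (0 < r ^ m)%N by rewrite expn_gt0 r_gt0.
  have -> : (2 * r ^ m.+1 - 1 = (2 * r ^ m - 1) * r + (r - 1))%N.
    by rewrite expnS; move: (r ^ m)%N rm_gt0 => x; nia.
  (* Here [m.+1 < r] gives [2 <= r], so the spare [r - 1] pays for the closures of the current
     layer. *)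
  have : (size Ts <= (r - 1) * size Ts)%N by rewrite leq_pmull // subn_gt0; lia.
  by rewrite mulnDl; lia.
apply: (spec_bind (spec_mapM (fun T _ => spec_closure_op T))).
move=> Tbars [sz TsTb TbTs].
set Us := flatten _.
have szUs : (size Us <= size Ts * r)%N.
  rewrite -sz /Us; elim: (Tbars) => //= V s IHs.
  rewrite size_cat mulSn leq_add // size_map -cardE.
  by rewrite -[leqRHS](card_ord r) max_card.
have child T j :
    T \in Ts -> j \notin closure_rows T -> j |: closure_rows T \in Us.
  move=> /TsTb[_ /[swap]-> TTb] jT; apply/flattenP.
  exists (children (closure_rows T)); first exact: map_f.
  by apply: map_f; rewrite mem_enum inE.
have childP U : U \in Us -> exists2 T, T \in Ts &
    exists2 j, j \notin closure_rows T & U = j |: closure_rows T.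
  move=> /flattenP[_ /mapP[V /TbTs[T TTs ->] ->] /mapP[j]].
  by rewrite mem_enum inE => jT ->; exists T => //; exists j.
apply: spec_weaken (IHm Us (ltnW lt_mr)) _ _; last first.
  by rewrite leq_mul2r leq_mul2l szUs !orbT.
move=> Vs [szVs VsUs UsVs]; split.
- by rewrite expnS mulnA; apply: leq_trans szVs _; rewrite leq_mul2r szUs orbT.
- move=> V /VsUs[U /childP[T TTs [j jT ->]]].
  by rewrite rank_rows_in_child // addSnnS => le_VT; exists T.
move=> T U TTs sTU /andP[leUT ltTY].
(* The target [U] is enlarged by the flat and by [j], so that it contains the child. A row of [U]
   outside the flat costs no extra rank; if there is none, any [j] outside the flat will do, and one
   exists because the rank of [T] is below that of [Y]. *)
have [j [jT leU']] : exists j, j \notin closure_rows T /\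
    (\rank (rows_in Y (j |: (closure_rows T :|: U)))
       <= \rank (rows_in Y T) + m.+1)%N.
  have [sU|/subsetPn[j jU jT]] := boolP (U \subset closure_rows T).
    have [|j jT] := @exists_notin_closure T.
      by apply: leq_ltn_trans ltTY; rewrite leq_addr.
    exists j; split=> //; rewrite (setUidPl sU) rank_rows_in_child //.
    by rewrite addnS ltnS leq_addr.
  exists j; split=> //; rewrite (setUidPr _) ?rank_rows_inU_closure //.
  by rewrite sub1set inE jU orbT.
have [||V VVs sV] := UsVs _ (j |: (closure_rows T :|: U)) (child T j TTs jT).
- by rewrite setUS ?subsetUl.
- by rewrite rank_rows_in_child // addSnnS leU'.
by exists V => //; apply: subset_trans sV; rewrite setUA subsetUr.
Qed.

End RowMatroid.

(** * One eigenvalue: a largest rank-deficient set of rows *)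

(** The tree starts at rank 0 and has [k] layers, so its final sets have rank below [k], and every
    set of rank below [k] lies in one of them. *)
Lemma spec_max_corank1 (c : nat) (F : fieldType) (r n k : nat)
    (C : 'M[F]_(r, n)) (X : 'M[F]_(n, k)) :
  (0 < k)%N -> \rank (C *m X) = k ->
  spec (let! Y := mul_op C X in
        let! Tbars := layers c Y k.-1 [:: set0] in
        let! Tmax := max_card_op Tbars in
        ret (~: Tmax))
    (fun S => (\rank (rows_in (C *m X) (~: S)) < k)%N /\
       forall U, (\rank (rows_in (C *m X) U) < k)%N -> (#|S| <= #|~: U|)%N)
    (r * k * (n + n.-1) + (4 * c + 4) * (k ^ 2 * r ^ k.+1)).
Proof.
move=> k_gt0 rankY.
have le_kr : (k <= r)%N by rewrite -[leqLHS]rankY rank_leq_row.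
have r_gt0 := leq_trans k_gt0 le_kr.
have lt_pk : (k.-1 < r)%N by rewrite prednK.
set m := k.-1; pose B := (c.*2.+1 * (k ^ 2 * r ^ 2))%N.
apply: (@spec_leq _ _ _ (r * k * (n + n.-1) +
  ((2 * r ^ m - 1) * 1 * B + ((r ^ m * r + r ^ m) + 0)))).
- apply: (spec_bind (spec_mul_op _ _)) => _ ->.
  apply: spec_bind.
    exact: (spec_layers _ c k_gt0 r_gt0 [:: set0] lt_pk).
  move=> Vs [szVs lowVs maxVs].
  have cover U : (\rank (rows_in (C *m X) U) < k)%N ->
      exists2 V, V \in Vs & U \subset V.
    move=> ltUk; apply: (maxVs set0); rewrite ?mem_head ?sub0set //.
    by rewrite rank_rows_in0 add0n rankY prednK // leqnn andbT -ltnS prednK.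
  (* The empty set must be covered too, so [max_card_op] is not stuck. *)
  have Vs_gt0 : (0 < size Vs)%N.
    have [|V] := cover set0; first by rewrite rank_rows_in0.
    by case: (Vs).
  apply: (@spec_bind _ _ _ _
    (fun T => T \in Vs /\ forall U, U \in Vs -> (#|U| <= #|T|)%N)).
    apply: spec_weaken (spec_max_card_op Vs_gt0) _ _ => //.
    by move: szVs; rewrite mul1n => szVs; rewrite leq_add // leq_mul2r szVs orbT.
  move=> T [TVs maxT]; apply: spec_ret; rewrite /= setCK; split.
    have [V] := lowVs T TVs; rewrite inE => /eqP->.
    by rewrite rank_rows_in0 add0n -ltnS prednK.
  move=> U /cover[V VVs sUV]; rewrite cardsCs [leqRHS]cardsCs !setCK leq_sub2l //.
  exact: leq_trans (subset_leq_card sUV) (maxT V VVs).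
have rS : (r ^ k.+1 = r ^ m * r ^ 2)%N by rewrite -expnD addn2 /m prednK.
rewrite leq_add2l muln1 addn0 rS (mulnCA (k ^ 2)%N).
pose M := (k ^ 2 * r ^ 2)%N.
have k2_gt0 : (0 < k ^ 2)%N by rewrite expn_gt0 k_gt0.
have M_gt0 : (0 < M)%N by rewrite muln_gt0 k2_gt0 expn_gt0 r_gt0.
have le_rM : (r <= M)%N.
  by apply: leq_trans (leq_pmull _ k2_gt0); rewrite -mulnn leq_pmulr.
(* Twice [c.*2.+1] pays for the tree; the remaining 2 pay for the cardinalities and their
   comparisons. *)
have -> : ((4 * c + 4) * (r ^ m * M) =
    2 * r ^ m * (c.*2.+1 * M) + (r ^ m * M + r ^ m * M))%N by rewrite -muln2; ring.
rewrite leq_add ?leq_mul2r ?leq_subr ?orbT // leq_add ?leq_mul2l ?le_rM ?orbT //.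
by rewrite leq_pmulr.
Qed.

(** * Eigenvectors and unobservability *)

(** A nonzero column of the cokernel is a kernel vector; conversely, full column rank gives a left
    inverse. *)
Lemma rank_lt_colP (F : fieldType) (m k : nat) (M : 'M[F]_(m, k)) :
  (\rank M < k)%N <-> exists2 x : 'cV[F]_k, x != 0 & M *m x = 0.
Proof.
split=> [ltMk|[x x0 Mx]]; last first.
  rewrite ltn_neqAle rank_leq_col andbT; apply: contra x0 => /row_fullP[B BM].
  by rewrite -[x]mul1mx -BM -mulmxA Mx mulmx0.
have: cokermx M != 0 by rewrite -mxrank_eq0 mxrank_coker -lt0n subn_gt0.
move=> /matrix0Pn[i [j cij]]; exists (col j (cokermx M)).
  by apply: contra cij => /eqP/matrixP/(_ i 0); rewrite !mxE => ->.
by rewrite colE mulmxA mulmx_coker mul0mx.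
Qed.

Section Systems.

Variables (R : realType) (n r : nat) (A : 'M[R]_n) (C : 'M[R]_(r, n)).

Lemma geo_multE z : geo_mult A z = (n - \rank (toC A - z%:M)%R)%N.
Proof. by rewrite /geo_mult mxrank_coker -opprB mxrank_opp. Qed.

(** [eigenvalue] refers to row eigenvectors, [geo_mult] to column ones; left and right null spaces
    of a square matrix have equal dimension. *)
Lemma eigenvalue_geo_mult z : eigenvalue (toC A) z = (0 < geo_mult A z)%N.
Proof.
by rewrite geo_multE /eigenvalue /eigenspace -mxrank_eq0 mxrank_ker -lt0n.
Qed.

Lemma geo_mult_le z : (geo_mult A z <= n)%N.
Proof. by rewrite geo_multE leq_subr. Qed.

Variables (p : nat) (lam : 'I_p -> R[i]).
Variable X : forall i : 'I_p, 'M[R[i]]_(n, geo_mult A (lam i)).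
Hypothesis lamP : enumerates_eigenvalues A lam.
Hypothesis XP : forall i, null_basis ((lam i)%:M - toC A) (X i).

Lemma card_eigenvalues : (p <= n)%N.
Proof.
have [lam_inj lam_ev] := lamP.
have := @max_poly_roots _ (char_poly (toC A)) (codom lam).
rewrite size_codom card_ord size_char_poly ltnS; apply.
- by rewrite -size_poly_eq0 size_char_poly.
- apply/allP=> z /codomP[i ->]; rewrite -eigenvalue_root_char.
  by apply/lam_ev; exists i.
- by apply/injectiveP.
Qed.

(** The characteristic polynomial has a root in [R[i]]. This ensures that [min_card_op] has a set to
    choose. *)
Lemma card_eigenvalues_gt0 : (0 < n)%N -> (0 < p)%N.
Proof.
move=> n_gt0; have [_ lam_ev] := lamP.
have [|z rz] := @closed_rootP _ (char_poly (toC A)) _.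
  by rewrite size_char_poly; case: (n) n_gt0.
have /lam_ev[i _] : eigenvalue (toC A) z by rewrite eigenvalue_root_char.
by case: i => i; apply: leq_ltn_trans.
Qed.

Lemma null_basis_eigenvector i (u : 'cV_(geo_mult A (lam i))) :
  u != 0 ->
  X i *m u != 0 /\ toC A *m (X i *m u) = lam i *: (X i *m u).
Proof.
have [nullX freeX] := XP i; move=> u0; split.
  by apply: contra u0 => /eqP/freeX->.
have: ((lam i)%:M - toC A) *m (X i *m u) = 0 by apply/nullX; exists u.
by rewrite mulmxBl mul_scalar_mx => /eqP; rewrite subr_eq0 => /eqP.
Qed.

Lemma unobservable_rows (T : {set 'I_r}) :
  unobservable A (rows_in C T) <->
  exists i, (\rank (rows_in (toC C *m X i) T) < geo_mult A (lam i))%N.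
Proof.
have [_ lam_ev] := lamP.
have rowsX i : rows_in (toC C *m X i) T = toC (rows_in C T) *m X i.
  by rewrite /rows_in /toC map_mxsub -mul_rowsub_mx.
split=> [[z [x [x0 Ax Cx]]]|[i /rank_lt_colP[u u0]]].
  have zx : (z%:M - toC A) *m x = 0 by rewrite mulmxBl mul_scalar_mx Ax subrr.
  have /lam_ev[i zi] : eigenvalue (toC A) z.
    rewrite eigenvalue_geo_mult /geo_mult mxrank_coker subn_gt0.
    by apply/rank_lt_colP; exists x.
  have /(XP i).1[u xu] : ((lam i)%:M - toC A) *m x = 0 by rewrite zi.
  exists i; apply/rank_lt_colP; exists u; last by rewrite rowsX -mulmxA -xu.
  by apply: contra x0 => /eqP u0; rewrite xu u0 mulmx0.
rewrite rowsX -mulmxA => Cu; exists (lam i), (X i *m u).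
by have [Xu0 AXu] := null_basis_eigenvector u0; split.
Qed.

(** A kernel vector [u] would make [X i *m u] an unobservable eigenvector. The equality bounds each
    multiplicity by [r] and lets the tree reach full depth. *)
Lemma observable_rank i :
  observable A C -> \rank (toC C *m X i) = geo_mult A (lam i).
Proof.
move=> obsC; apply/eqP; rewrite eqn_leq rank_leq_col leqNgt /=.
apply/negP=> /rank_lt_colP[u u0]; rewrite -mulmxA => Cu; apply: obsC.
exists (lam i), (X i *m u).
by have [Xu0 AXu] := null_basis_eigenvector u0; split.
Qed.

End Systems.

(** * Optimality and total cost *)

Theorem theorem2 (R : realType) (c : nat) :
  exists K : nat,
  forall (n r kbar : nat) (A : 'M[R]_n) (C : 'M[R]_(r, n))
         (p : nat) (lam : 'I_p -> R[i])
         (X : forall i : 'I_p, 'M[R[i]]_(n, geo_mult A (lam i))),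
    (0 < n)%N ->
    observable A C ->
    (forall i : 'I_r, row i C != 0) ->
    (forall z : R[i], eigenvalue (toC A) z -> (geo_mult A z <= kbar)%N) ->
    enumerates_eigenvalues A lam ->
    (forall i : 'I_p, null_basis ((lam i)%:M - toC A) (X i)) ->
    (exists (F : {set 'I_r}) (t : nat), algorithm1 c (toC C) X F t) /\
    (forall (F : {set 'I_r}) (t : nat), algorithm1 c (toC C) X F t ->
       optimal_solution A C F /\
       (t <= K * (kbar ^ 2 * r ^ kbar.+1 * n + r * n ^ 3))%N).
Proof.
(* The trees dictate this factor. The products and the final selection cost at most
   [2 * (r * n ^ 3)] each, and [4 <= 4 * c + 4]. *)
exists (4 * c + 4)%N => n r kbar A C p lam X n_gt0 obsC _ le_kbar lamP XP.
have p_gt0 := card_eigenvalues_gt0 lamP n_gt0.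
have le_pn := card_eigenvalues lamP.
have lam_ev i : eigenvalue (toC A) (lam i) by apply/lamP.2; exists i.
have k_gt0 i : (0 < geo_mult A (lam i))%N by rewrite -eigenvalue_geo_mult.
have rankY i := observable_rank XP i obsC.
have le_kr i : (geo_mult A (lam i) <= r)%N by rewrite -rankY rank_leq_row.
have r_gt0 : (0 < r)%N.
  by apply: leq_trans (le_kr (Ordinal p_gt0)); apply: k_gt0.
pose D := (kbar ^ 2 * r ^ kbar.+1)%N.
pose B := (r * n * (n + n.-1) + (4 * c + 4) * D)%N.
suff: spec (algorithm1 c (toC C) X) (optimal_solution A C)
        ((4 * c + 4) * (D * n + r * n ^ 3)).
  by [].
apply: (@spec_leq _ _ _ (p * B + (p * r + p))).
  have branch i := spec_max_corank1 c (k_gt0 i) (rankY i).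
  rewrite -[X in (X * B)%N](size_enum_ord p).
  apply: spec_bind.
    apply: spec_mapM => i _; apply: spec_leq (branch i) _.
    (* The product is bounded through multiplicity at most [n], the tree through multiplicity at
       most [kbar]. *)
    rewrite leq_add // ?leq_mul2r ?leq_mul2l ?geo_mult_le ?orbT //.
    apply/orP; right; rewrite leq_mul ?leq_sqr ?le_kbar //.
    by rewrite leq_pexp2l ?ltnS ?le_kbar.
  move=> Fs [szFs inFs Fs_in]; rewrite size_enum_ord in szFs.
  have Fs_gt0 : (0 < size Fs)%N by rewrite szFs.
  rewrite -szFs.
  apply: spec_weaken (spec_min_card_op Fs_gt0) _ (leqnn _) => S [SFs minS].
  have [i _ [ltS _]] := Fs_in S SFs.
  split; first by apply/(unobservable_rows C lamP XP); exists i.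
  move=> S' /(unobservable_rows C lamP XP)[j ltS'].
  (* Branch [j] returns a set [S''] no larger than [S'], and [S] is no larger than [S'']. *)
  have [S'' S''Fs [_ /(_ _ ltS')]] := inFs j (mem_enum _ _).
  by rewrite setCK; apply: leq_trans; apply: minS.
have n2_gt0 : (0 < n ^ 2)%N by rewrite expn_gt0 n_gt0.
have n3E : (n ^ 3 = n * n ^ 2)%N by rewrite -expnS.
have le_B : (p * B <= n * B)%N by rewrite leq_mul2r le_pn orbT.
have le_prp : (p * r + p <= 2 * (r * n ^ 3))%N.
  rewrite -mulnSr n3E; apply: (@leq_trans (n * (2 * r)))%N.
    by rewrite leq_mul //; lia.
  by rewrite mulnCA leq_mul2l (mulnC n r) leq_mul2l leq_pmulr ?orbT.
have le_Bn : (n * B <= 2 * (r * n ^ 3) + (4 * c + 4) * (D * n))%N.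
  rewrite /B mulnDr (mulnC n (_ * D)%N) -(mulnA _ D n) leq_add2r.
  have -> : (2 * (r * n ^ 3) = n * (r * n * (n + n)))%N by rewrite n3E; ring.
  by rewrite !leq_mul2l leq_add2l leq_pred !orbT.
rewrite mulnDr addnC; apply: leq_trans (leq_add le_prp (leq_trans le_B le_Bn)) _.
rewrite addnA -mulnDl addnC leq_add2l leq_mul2r; apply/orP; right; lia.
Qed.
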